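(* There is no symmetric association scheme $\mathscr{X}$ with $d=5$ classes such that $\mathscr{X}$ is not a polygon and such that the primitive idempotents of $\mathscr{X}$ can be labelled $E_0, E_1, E_2, E_3, E_4, E_5$ (with $E_0=|X|^{-1}J$, where $X$ is the vertex set of $\mathscr{X}$ and $J$ is the all-ones matrix) so that both orderings $$E_0, E_1, E_2, E_3, E_4, E_5 \qquad\text{and}\qquad E_0, E_5, E_3, E_2, E_4, E_1$$ are $Q$-polynomial structures for $\mathscr{X}$.
   Context: A symmetric association scheme with $d$ classes is a pair $\mathscr{X}=(X,\{R_i\}_{i=0}^d)$, where $X$ is a finite set and $R_0,\dots,R_d$ are nonempty symmetric relations partitioning $X\times X$, with $R_0=\{(x,x):x\in X\}$, such that for all $0\le i,j,k\le d$ there is a number $p^k_{ij}$ with $|\{z\in X:(x,z)\in R_i,(z,y)\in R_j\}|=p^k_{ij}$ for every $(x,y)\in R_k$. Let $A_i$ be the adjacency ($0$-$1$) matrix of $R_i$, so that $A_0=I$, $\sum_i A_i=J$ (the all-ones matrix), and $A_iA_j=\sum_{k=0}^d p^k_{ij}A_k$. The real span $\mathscr{M}$ of $A_0,\dots,A_d$ is a commutative algebra of symmetric matrices of dimension $d+1$ (the Bose-Mesner algebra). It has a unique (up to order) basis of primitive idempotents $E_0,E_1,\dots,E_d$ (mutually orthogonal nonzero idempotents summing to $I$), one of which is $E_0=|X|^{-1}J$. Since $\mathscr{M}$ is closed under the entrywise (Hadamard) product $\circ$, the Krein parameters $q^k_{ij}$ are defined, with respect to a given labelling of the primitive idempotents,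 by $$E_i\circ E_j=|X|^{-1}\sum_{k=0}^d q^k_{ij}E_k .$$ An ordering $E_0,E_1,\dots,E_d$ of the primitive idempotents (with $E_0=|X|^{-1}J$) is called a $Q$-polynomial structure for $\mathscr{X}$ if, with respect to this ordering, for all $0\le i,j,k\le d$: (Q1) $q^k_{ij}=0$ whenever one of $i,j,k$ is greater than the sum of the other two; and (Q2) $q^k_{ij}\neq 0$ whenever one of $i,j,k$ is equal to the sum of the other two. For another ordering $E_{\pi(0)},\dots,E_{\pi(d)}$, the same conditions are imposed on the numbers $q^{\pi(k)}_{\pi(i)\pi(j)}$. A polygon is the association scheme of an ordinary $n$-gon: $X$ is the vertex set of the cycle graph $C_n$, and $(x,y)\in R_i$ if and only if the graph distance between $x$ and $y$ in $C_n$ is $i$ (for some ordering of the relations). *)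

(* Defs.v *)
From mathcomp Require Import all_boot all_order all_algebra all_fingroup.

Set Implicit Arguments.
Unset Strict Implicit.
Unset Printing Implicit Defensive.

Import GRing.Theory.
Local Open Scope ring_scope.

Record symmetric_scheme (X : finType) (d : nat) := SymmetricScheme {
  srel :> 'I_d.+1 -> rel X;
  srel_nonempty : forall i, exists x y, srel i x y;
  srel_sym : forall i, symmetric (srel i);
  srel_partition : forall x y, exists! i, srel i x y;
  srel0 : forall x y, srel ord0 x y = (x == y);
  srel_intersection : exists p : 'I_d.+1 -> 'I_d.+1 -> 'I_d.+1 -> nat,
    forall i j k x y, srel k x y ->
      #|[set z | srel i x z && srel j z y]| = p i j k }.

(* [ordS] is the cyclic successor, so this is C_n for n >= 3. *)
Definition cycle_graph (n : nat) : rel 'I_n :=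
  fun u v => (v == ordS u) || (u == ordS v).

Definition graph_distance (T : finType) (e : rel T) (u v : T) (k : nat) : Prop :=
  (exists p : seq T, [/\ path e u p, last u p = v & size p = k]) /\
  (forall p : seq T, path e u p -> last u p = v -> (k <= size p)%N).

(* The permutation s is the ordering of the relations. *)
Definition polygon (X : finType) (d : nat) (S : symmetric_scheme X d) : Prop :=
  exists (n : nat) (f : X -> 'I_n) (s : 'S_d.+1),
    [/\ (3 <= n)%N, bijective f &
      forall i x y, S (s i) x y <-> graph_distance (@cycle_graph n) (f x) (f y) i].

Section BoseMesner.
Variables (R : fieldType) (X : finType) (d : nat).
Implicit Types (S : symmetric_scheme X d) (E : d.+1.-tuple 'M[R]_#|X|).

(* Matrices with rows and columns labelled by X are encoded as square matrices
   of order #|X| through the enumeration of X. *)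
Definition adjacency S (i : 'I_d.+1) : 'M[R]_#|X| :=
  \matrix_(a, b) (S i (enum_val a) (enum_val b))%:R.

Definition bose_mesner S : {vspace 'M[R]_#|X|} :=
  <<[seq adjacency S i | i : 'I_d.+1]>>%VS.

Definition hadamard (n : nat) (A B : 'M[R]_n) : 'M[R]_n := map2_mx *%R A B.

Definition primitive_idempotents S E : Prop :=
  [/\ basis_of (bose_mesner S) E,
      forall i, tnth E i != 0,
      forall i j, tnth E i *m tnth E j = (if i == j then tnth E i else 0) &
      \sum_i tnth E i = 1%:M].

(* [krein E i j k] is q^k_ij with respect to the labelling E; [coord] is only
   meaningful because E is a basis of the Bose-Mesner algebra, which is closed
   under [hadamard] (see [kreinE] and [hadamard_bose_mesner]). *)
Definition krein E (i j k : 'I_d.+1) : R :=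
  #|X|%:R * coord E k (hadamard (tnth E i) (tnth E j)).

(* An ordering of the primitive idempotents is given by the tuple E itself; by
   [krein_relabel], the Krein parameters of a reordering along s are those of
   E at the indices s i, s j, s k. *)
Definition Q_polynomial S E : Prop :=
  [/\ primitive_idempotents S E,
      tnth E ord0 = #|X|%:R^-1 *: const_mx 1,
      forall i j k : 'I_d.+1,
        [|| i > j + k, j > i + k | k > i + j]%N -> krein E i j k = 0 &
      forall i j k : 'I_d.+1,
        [|| i == j + k :> nat, j == i + k :> nat | k == i + j :> nat]%N ->
        krein E i j k != 0].

End BoseMesner.

Section KreinTheory.
Variables (R : fieldType) (X : finType) (d : nat).
Implicit Types (S : symmetric_scheme X d) (E : d.+1.-tuple 'M[R]_#|X|).

Lemma hadamard_adjacency S i j :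
  hadamard (adjacency R S i) (adjacency R S j) =
  if i == j then adjacency R S i else 0.
Proof.
apply/matrixP=> a b; rewrite !mxE.
case: eqVneq => [->|neq_ij].
  by rewrite mxE; case: (S _ _ _); rewrite ?mulr1 ?mulr0.
rewrite mxE; case Si: (S i _ _); case Sj: (S j _ _); rewrite ?mulr0 ?mul0r //.
have [k [_ uniq_k]] := srel_partition S (enum_val a) (enum_val b).
by case/eqP: neq_ij; rewrite -(uniq_k i Si) (uniq_k j Sj).
Qed.

Lemma hadamard_bose_mesner S (A B : 'M[R]_#|X|) :
  A \in bose_mesner R S -> B \in bose_mesner R S ->
  hadamard A B \in bose_mesner R S.
Proof.
set s := [seq adjacency R S i | i : 'I_d.+1].
move=> /(@coord_span _ _ _ (in_tuple s)) -> /(@coord_span _ _ _ (in_tuple s)) ->.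
set a := coord _; set u := fun k => a k A; set v := fun k => a k B.
have -> : hadamard (\sum_k u k *: s`_k) (\sum_k v k *: s`_k) =
    \sum_k \sum_l (u k * v l) *: hadamard s`_k s`_l.
  apply/matrixP=> x y; rewrite mxE !summxE mulr_suml; apply: eq_bigr => k _.
  rewrite summxE mulr_sumr; apply: eq_bigr => l _.
  by rewrite !mxE mulrACA.
have sP (k : 'I_(size s)) : exists i, s`_k = adjacency R S i.
  by have /imageP[i _ ->] := mem_nth 0 (ltn_ord k); exists i.
apply: memv_suml => k _; apply: memv_suml => l _; apply: memvZ.
have [[i ->] [j ->]] := (sP k, sP l).
rewrite hadamard_adjacency; case: eqP => _; last exact: mem0v.
by apply: memv_span; apply/imageP; exists i.
Qed.

Lemma kreinE (S : symmetric_scheme X d) E i j :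
  #|X|%:R != 0 :> R -> primitive_idempotents S E ->
  hadamard (tnth E i) (tnth E j) =
  #|X|%:R^-1 *: \sum_k krein E i j k *: tnth E k.
Proof.
move=> nzX [basisE _ _ _].
have memE k : tnth E k \in bose_mesner R S.
  exact: basis_mem basisE (mem_tnth _ _).
rewrite {1}(coord_basis basisE (hadamard_bose_mesner (memE i) (memE j))).
rewrite scaler_sumr; apply: eq_bigr => k _.
by rewrite scalerA /krein mulrA mulVf // mul1r -tnth_nth.
Qed.

Lemma krein_relabel (S : symmetric_scheme X d) E (s : 'S_d.+1) i j k :
  primitive_idempotents S E ->
  krein [tuple tnth E (s l) | l < d.+1] i j k = krein E (s i) (s j) (s k).
Proof.
move=> [basisE _ _ _]; set F := [tuple _ | l < _].
have memE l : tnth E l \in bose_mesner R S.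
  exact: basis_mem basisE (mem_tnth _ _).
have tF l : tnth F l = tnth E (s l) by rewrite tnth_mktuple.
have FE : perm_eq F E by apply/tuple_permP; exists s.
have freeF : free F by rewrite (perm_free FE) (basis_free basisE).
rewrite /krein !tF; congr (_ * _).
set v := hadamard _ _.
have vM : v \in bose_mesner R S by apply: hadamard_bose_mesner.
rewrite {1}(coord_basis basisE vM) (reindex_inj (@perm_inj _ s)) /=.
under eq_bigr => l _ do rewrite -tnth_nth -tF (tnth_nth 0).
by rewrite (coord_sum_free (fun l => coord E (s l) v)).
Qed.

End KreinTheory.

(* Main.v *)
(* Write q(i,j,k) for the Krein parameters divided by |X|. The exchange of the
   two orderings is the involution (1 5)(2 3) of the labels. Let D_i(x) be the
   diagonal matrix carrying row x of E_i. By positivity, q(i,j,k) = 0 forces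
   E_k D_i(x) E_j = 0 for every x, so each D_1(x) is block tridiagonal for the
   first ordering, with zero diagonal block at 3, and each D_5(y) is so for the
   second. The D's commute, and comparing blocks makes products of blocks
   symmetric in their base points.
   - E_4 D_1(k) E_4 D_1(f) E_3 D_1(g) E_2 is symmetric in k, f, g; contracting
     it with tau(k,f,c) = sum_w E_1(k,w) E_1(f,w) E_1(c,w), in the places k, f
     or f, g, gives q(1,1,1) times a nonzero product, and 0. So q(1,1,1) = 0.
   - Then t(h,r,s) = E_2 D_1(h) E_2 D_1(r) E_1 e_s is symmetric in h, r, s, and
     < t(h,r,s), E_2 D_1(x) E_3 D_5(y) E_2 D_1(a) E_1 e_b > is symmetric in its
     six indices x, a, b, h, r, s. Contracting it with t in h, r, s or in
     x, a, b gives q(1,2,2) times a nonzero vector, and 0. So q(1,2,2) = 0.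
   Exchanging the orderings also gives q(5,3,3) = 0. But then the coefficient
   of E_2 in E_5 o (E_1 o E_3) = E_1 o (E_5 o E_3) reads
   q(1,3,4) q(5,4,2) = 0, although both factors are nonzero. *)
Require Import Defs.
From mathcomp Require Import all_boot all_order all_algebra.
From mathcomp Require Import perm reals.

Set Implicit Arguments.
Unset Strict Implicit.
Unset Printing Implicit Defensive.

Import GRing.Theory Num.Theory.
Local Open Scope ring_scope.

(** * Diagonal matrices built from the rows of a matrix *)

Section RowMultiplication.
Variables (R : realFieldType) (N : nat).
Implicit Types A B C : 'M[R]_N.

Definition row_diag A (x : 'I_N) : 'M[R]_N := diag_mx (row x A).

Lemma tr_row_diag A x : (row_diag A x)^T = row_diag A x.
Proof. exact: tr_diag_mx. Qed.

Lemma row_diagC A B x y :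
  row_diag A x *m row_diag B y = row_diag B y *m row_diag A x.
Proof. exact: diag_mx_comm. Qed.

Lemma row_diag_colC A r s : A^T = A ->
  row_diag A r *m col s A = row_diag A s *m col r A.
Proof.
move=> symA; apply/matrixP=> w j; rewrite !mul_diag_mx !mxE mulrC.
by rewrite -[in A w s]symA -[in A r w]symA !mxE.
Qed.

Lemma sum_col_mul_row A : A^T = A -> A *m A = A ->
  \sum_s col s A *m (col s A)^T = A.
Proof.
move=> symA idA; rewrite -[RHS]idA; apply/matrixP=> a b.
rewrite summxE mxE; apply: eq_bigr => s _.
by rewrite !mxE big_ord1 !mxE -[in A b s]symA mxE.
Qed.

(** Entry [(a, b)] of the sum is [B a b] times the sum of [A x a * A x b] over [x], which is [A a b]
    since [A] is a symmetric idempotent. *)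
Lemma sum_row_diag_mul A B : A^T = A -> A *m A = A ->
  \sum_x row_diag A x *m B *m row_diag A x = hadamard A B.
Proof.
move=> symA idA; apply/matrixP=> a b; rewrite summxE [RHS]mxE.
rewrite -[in RHS]idA mxE mulr_suml; apply: eq_bigr => x _.
by rewrite mul_mx_diag mul_diag_mx !mxE mulrAC -[in A x a]symA mxE.
Qed.

Lemma sum_mulmx_tr_eq0 (m n : nat) (F : 'I_N -> 'M[R]_(m, n)) :
  \sum_x F x *m (F x)^T = 0 -> forall x, F x = 0.
Proof.
move=> F0 x; apply/matrixP=> i j; rewrite mxE; apply/eqP.
have: (\sum_x F x *m (F x)^T) i i = 0 by rewrite F0 mxE.
rewrite summxE => /eqP; rewrite psumr_eq0 => [/allP/(_ x)|y _]; last first.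
  by rewrite mxE sumr_ge0 // => k _; rewrite mxE -expr2 sqr_ge0.
rewrite mem_index_enum mxE => /(_ isT); rewrite psumr_eq0 => [/allP/(_ j)|k _].
  by rewrite mem_index_enum mxE -expr2 sqrf_eq0 => /(_ isT).
by rewrite mxE -expr2 sqr_ge0.
Qed.

(** Put [F x = C *m row_diag A x *m B]. The positive semidefinite matrices [F x *m (F x)^T] add up
    to [C *m hadamard A B *m C = 0], so each of them vanishes. *)
Lemma row_diag_eq0 A B C : A^T = A -> A *m A = A -> B^T = B -> B *m B = B ->
  C^T = C -> hadamard A B *m C = 0 -> forall x, C *m row_diag A x *m B = 0.
Proof.
move=> symA idA symB idB symC ABC0.
apply: sum_mulmx_tr_eq0; transitivity (C *m hadamard A B *m C); last first.
  by rewrite -mulmxA ABC0 mulmx0.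
rewrite -sum_row_diag_mul // mulmx_sumr mulmx_suml; apply: eq_bigr => x _.
by rewrite !trmx_mul tr_row_diag symB symC -{3}idB !mulmxA.
Qed.

Lemma hadamardC A B : hadamard A B = hadamard B A.
Proof. by apply/matrixP=> a b; rewrite !mxE mulrC. Qed.

Lemma hadamardA A B C :
  hadamard A (hadamard B C) = hadamard (hadamard A B) C.
Proof. by apply/matrixP=> a b; rewrite !mxE mulrA. Qed.

Lemma hadamard_sumr A I (r : seq I) P (F : I -> 'M[R]_N) :
  hadamard A (\sum_(i <- r | P i) F i) = \sum_(i <- r | P i) hadamard A (F i).
Proof.
apply/matrixP=> a b; rewrite mxE !summxE mulr_sumr.
by apply: eq_bigr => i _; rewrite mxE.
Qed.

Lemma hadamardZr A a B : hadamard A (a *: B) = a *: hadamard A B.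
Proof. by apply/matrixP=> x y; rewrite !mxE mulrCA. Qed.

End RowMultiplication.

(* The position in the second ordering of the idempotent labelled i. *)
Definition pos (i : nat) : nat := nth 0%N [:: 0; 5; 3; 2; 4; 1]%N i.

Definition triangle (i j k : nat) : bool :=
  ~~ [|| i > j + k, j > i + k | k > i + j]%N.

Definition degenerate (i j k : nat) : bool :=
  [|| i == j + k, j == i + k | k == i + j]%N.

(** These are the triples that (Q1) does not force to vanish in either ordering. *)
Definition admissible (i j k : nat) : bool :=
  triangle i j k && triangle (pos i) (pos j) (pos k).

(** * Idempotents and Krein parameters under two Q-polynomial orderings *)

Section Exceptional.
Variables (R : realFieldType) (N : nat).

(** Labels are natural numbers, so that conditions on concrete labels are settled by computation.
    The Krein parameter divided by |X| appears as the eigenvalue of [hadamard (E i) (E j)] on the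
    range of [E k]. *)
Record exceptional (E : nat -> 'M[R]_N) (q : nat -> nat -> nat -> R) : Prop :=
  Exceptional {
    exc_sym : forall i, (i < 6)%N -> (E i)^T = E i;
    exc_mul : forall i j, (i < 6)%N -> (j < 6)%N ->
      E i *m E j = if i == j then E i else 0;
    exc_sum : \sum_(i < 6) E i = 1%:M;
    exc_neq0 : forall i, (i < 6)%N -> E i != 0;
    exc_krein : forall i j k, (i < 6)%N -> (j < 6)%N -> (k < 6)%N ->
      hadamard (E i) (E j) *m E k = q i j k *: E k;
    exc_q0 : forall i j k, (i < 6)%N -> (j < 6)%N -> (k < 6)%N ->
      ~~ admissible i j k -> q i j k = 0;
    exc_qN0 : forall i j k, (i < 6)%N -> (j < 6)%N -> (k < 6)%N ->
      degenerate i j k || degenerate (pos i) (pos j) (pos k) -> q i j k != 0 }.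

Lemma ltn_pos i : (i < 6)%N -> (pos i < 6)%N.
Proof. by move: i; do 6!case=> //. Qed.

Lemma posK i : (i < 6)%N -> pos (pos i) = i.
Proof. by move: i; do 6!case=> //. Qed.

(** As [pos] is an involution, the two orderings play symmetric roles, and every vanishing result
    transfers along [pos]. *)
Lemma exceptional_swap E q : exceptional E q ->
  exceptional (E \o pos) (fun i j k => q (pos i) (pos j) (pos k)).
Proof.
case=> symE mulE sumE E0 kE q0 qN0; split=> /=.
- by move=> i /ltn_pos; apply: symE.
- move=> i j i6 j6; rewrite mulE ?ltn_pos //.
  by rewrite (can_in_eq (D := [pred i | (i < 6)%N]) posK).
- have sum_iota (F : nat -> 'M[R]_N) :
      \sum_(i < 6) F i = \sum_(i <- iota 0 6) F i.
    by rewrite -(big_mkord xpredT F).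
  rewrite -sumE (sum_iota E) (sum_iota (E \o pos)) -(big_map pos xpredT E).
  exact: perm_big.
- by move=> i /ltn_pos; apply: E0.
- by move=> i j k /ltn_pos i6 /ltn_pos j6 /ltn_pos; apply: kE.
- move=> i j k i6 j6 k6 vanish; apply: q0; rewrite ?ltn_pos //.
  by rewrite /admissible !posK // andbC.
- move=> i j k i6 j6 k6 deg; apply: qN0; rewrite ?ltn_pos //.
  by rewrite !posK // orbC.
Qed.

End Exceptional.

(** * Block calculus and two vanishing Krein parameters *)

Section Vanishing.
Variables (R : realFieldType) (N : nat) (E : nat -> 'M[R]_N).
Variable q : nat -> nat -> nat -> R.
Hypothesis excE : exceptional E q.

Local Notation D i x := (row_diag (E i) x).

Lemma exc_idem i : (i < 6)%N -> E i *m E i = E i.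
Proof. by move=> i6; rewrite (exc_mul excE) // eqxx. Qed.

Lemma block_eq0 i j k x : (i < 6)%N -> (j < 6)%N -> (k < 6)%N ->
  q i j k = 0 -> E k *m D i x *m E j = 0.
Proof.
move=> i6 j6 k6 q0; apply: row_diag_eq0; rewrite ?exc_idem ?(exc_sym excE) //.
by rewrite (exc_krein excE) // q0 scale0r.
Qed.

Lemma exc_krein_l i j k : (i < 6)%N -> (j < 6)%N -> (k < 6)%N ->
  E k *m hadamard (E i) (E j) = q i j k *: E k.
Proof.
move=> i6 j6 k6; rewrite -[LHS]trmxK trmx_mul (exc_sym excE) //.
have -> : (hadamard (E i) (E j))^T = hadamard (E i) (E j).
  apply/matrixP=> a b; rewrite !mxE.
  by rewrite -[in E i b a](exc_sym excE) // -[in E j b a](exc_sym excE) // !mxE.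
by rewrite (exc_krein excE) // linearZ /= (exc_sym excE).
Qed.

Lemma sum_block i j k : (i < 6)%N -> (j < 6)%N -> (k < 6)%N ->
  \sum_x E k *m D i x *m E j *m D i x = q i j k *: E k.
Proof.
move=> i6 j6 k6; under eq_bigr => x _ do rewrite -!mulmxA.
rewrite -mulmx_sumr; under eq_bigr => x _ do rewrite mulmxA.
by rewrite sum_row_diag_mul ?exc_idem ?(exc_sym excE) // exc_krein_l.
Qed.

(** By [sum_block], a nonzero multiple of [E k] is a sum of terms starting with the blocks
    [E k *m D i x *m E j], so these blocks can be cancelled on the right. *)
Lemma block_cancel m (A : 'M_(m, N)) i j k :
  (i < 6)%N -> (j < 6)%N -> (k < 6)%N -> q i j k != 0 ->
  (forall x, A *m E k *m D i x *m E j = 0) -> A *m E k = 0.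
Proof.
move=> i6 j6 k6 qN0 A0; apply: (scalerI qN0); rewrite scaler0.
rewrite scalemxAr -sum_block // mulmx_sumr big1 // => x _.
by rewrite !mulmxA A0 mul0mx.
Qed.

(** Expand the identity between the two diagonal matrices as the sum of all [E j]; only the path
    from [k] to [l] through [m] survives. *)
Lemma insert_idem i i' m k l x y :
  (i < 6)%N -> (i' < 6)%N -> (m < 6)%N -> (k < 6)%N -> (l < 6)%N ->
  (forall j, (j < 6)%N -> j != m -> q i j k = 0 \/ q i' l j = 0) ->
  E k *m D i x *m D i' y *m E l = E k *m D i x *m E m *m D i' y *m E l.
Proof.
move=> i6 i'6 m6 k6 l6 H.
rewrite -[in LHS](mulmx1 (E k *m _)) -(exc_sum excE) mulmx_sumr.
rewrite !mulmx_suml (bigD1 (Ordinal m6)) //= big1 ?addr0 // => j jm.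
have [q0 | q0] := H j (ltn_ord j) jm.
  by rewrite (block_eq0 _ _ _ _ q0) // !mul0mx.
by rewrite -!mulmxA (mulmxA (E j)) (block_eq0 _ _ _ _ q0) // !mulmx0.
Qed.

Lemma insert_adm m i i' k l x y :
  (i < 6)%N -> (i' < 6)%N -> (m < 6)%N -> (k < 6)%N -> (l < 6)%N ->
  all (fun j => (j == m) || ~~ (admissible i j k && admissible i' l j))
    (iota 0 6) ->
  E k *m D i x *m D i' y *m E l = E k *m D i x *m E m *m D i' y *m E l.
Proof.
move=> i6 i'6 m6 k6 l6 /allP adm; apply: insert_idem => // j j6 /negPf jm.
have := adm j; rewrite mem_iota j6 jm /= negb_and => /(_ isT) /orP[] nadm.
  by left; apply: (exc_q0 excE).
by right; apply: (exc_q0 excE).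
Qed.

(** Each side equals the product without its middle idempotent, and there the diagonal matrices
    commute. *)
Lemma insert_adm_sym m m' i i' k l x y :
  (i < 6)%N -> (i' < 6)%N -> (m < 6)%N -> (m' < 6)%N -> (k < 6)%N ->
  (l < 6)%N ->
  all (fun j => (j == m) || ~~ (admissible i j k && admissible i' l j))
    (iota 0 6) ->
  all (fun j => (j == m') || ~~ (admissible i' j k && admissible i l j))
    (iota 0 6) ->
  E k *m D i x *m E m *m D i' y *m E l = E k *m D i' y *m E m' *m D i x *m E l.
Proof.
move=> *; rewrite -insert_adm // -[RHS]insert_adm //.
by rewrite -!(mulmxA (E k)) row_diagC.
Qed.

(** Summing over [k] and [f] first turns the entry at [x] into the sum of [E i c w * E i w x ^+ 2]
    over [w], an entry of [E i *m hadamard (E i) (E i)]. *)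
Lemma sum_triple i c : (i < 6)%N ->
  \sum_k \sum_f (\sum_w E i k w * E i f w * E i c w) *: (D i k *m D i f) =
  q i i i *: D i c.
Proof.
move=> i6; rewrite /row_diag.
transitivity (diag_mx (\sum_k \sum_f (\sum_w E i k w * E i f w * E i c w) *:
  \row_x (E i k x * E i f x))).
  rewrite linear_sum; apply: eq_bigr => k _.
  rewrite linear_sum; apply: eq_bigr => f _.
  rewrite linearZ /= mulmx_diag; congr (_ *: diag_mx _).
  by apply/rowP=> x; rewrite !mxE.
rewrite -linearZ /=; congr diag_mx; apply/rowP=> x; rewrite summxE !mxE.
transitivity (\sum_w E i c w * (E i w x * E i w x)); last first.
  have := congr1 (fun A : 'M_N => A c x) (exc_krein_l i6 i6 i6).
  by rewrite !mxE => <-; apply: eq_bigr => w _; rewrite mxE.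
under eq_bigr => k _.
  rewrite summxE; under eq_bigr => f _ do rewrite !mxE mulr_suml.
  rewrite exchange_big; over.
rewrite exchange_big; apply: eq_bigr => w _ /=.
have Ewx : E i w x = \sum_k E i k w * E i k x.
  rewrite -{1}(exc_idem i6) mxE; apply: eq_bigr => k _; congr (_ * _).
  by rewrite -{1}(exc_sym excE i6) mxE.
rewrite Ewx big_distrlr mulr_sumr; apply: eq_bigr => k _ /=.
rewrite mulr_sumr; apply: eq_bigr => f _.
by rewrite mulrAC [RHS]mulrC; congr (_ * _); rewrite mulrACA.
Qed.

Lemma exc_a1 : q 1 1 1 = 0.
Proof.
apply/eqP/negPn/negP => q111N0.
have swap12 k f : E 4 *m D 1 k *m E 4 *m D 1 f *m E 3 =
                  E 4 *m D 1 f *m E 4 *m D 1 k *m E 3.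
  exact: insert_adm_sym.
have swap23 f g : E 4 *m D 1 f *m E 3 *m D 1 g *m E 2 =
                  E 4 *m D 1 g *m E 3 *m D 1 f *m E 2.
  exact: insert_adm_sym.
have cyclic k f g : E 4 *m D 1 k *m E 4 *m D 1 f *m E 3 *m D 1 g *m E 2 =
    E 4 *m D 1 g *m E 4 *m D 1 k *m E 3 *m D 1 f *m E 2.
  transitivity (E 4 *m D 1 k *m (E 4 *m D 1 g *m E 3 *m D 1 f *m E 2)).
    by rewrite -swap23 !mulmxA.
  by rewrite !mulmxA swap12.
pose tau c k f := \sum_w E 1 k w * E 1 f w * E 1 c w.
have vanish c g : E 4 *m D 1 c *m E 3 *m D 1 g *m E 2 = 0.
  apply: (scalerI q111N0); rewrite scaler0.
  transitivity (\sum_k \sum_f tau c k f *: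
    (E 4 *m D 1 k *m E 4 *m D 1 f *m E 3 *m D 1 g *m E 2)).
    rewrite -!mulmxA scalemxAr scalemxAl -sum_triple // mulmx_suml mulmx_sumr.
    apply: eq_bigr => k _; rewrite mulmx_suml mulmx_sumr; apply: eq_bigr => f _.
    rewrite -scalemxAl -scalemxAr; congr (_ *: _); rewrite !mulmxA.
    by rewrite -insert_adm.
  (* After [cyclic], [k] and [f] surround [E 3], so the same contraction leaves a block between
     labels 4 and 2, which is zero because 4 > 1 + 2. *)
  transitivity (E 4 *m D 1 g *m (E 4 *m (q 1 1 1 *: D 1 c) *m E 2)).
    rewrite -sum_triple // mulmx_sumr mulmx_suml mulmx_sumr.
    apply: eq_bigr => k _; rewrite mulmx_sumr mulmx_suml mulmx_sumr.
    apply: eq_bigr => f _; rewrite cyclic -scalemxAr -scalemxAl -scalemxAr.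
    by rewrite (mulmxA (E 4) (D 1 k)) (insert_adm (m := 3)) // !mulmxA.
  rewrite -scalemxAr -scalemxAl (block_eq0 (i := 1)) ?scaler0 ?mulmx0 //.
  exact: (exc_q0 excE).
have E43 c : E 4 *m D 1 c *m E 3 = 0.
  apply: (block_cancel (i := 1) (j := 2)) => //.
  exact: (exc_qN0 excE).
have E4 : E 4 = 0.
  rewrite -(exc_idem (i := 4)) //.
  apply: (block_cancel (i := 1) (j := 3)) => // [|c].
    exact: (exc_qN0 excE).
  by rewrite exc_idem.
by have := exc_neq0 excE (isT : 4 < 6)%N; rewrite E4 eqxx.
Qed.

Lemma exc_a2 : q 1 2 2 = 0.
Proof.
have a1 := exc_a1.
pose phi s := col s (E 1).
have E1phi s : E 1 *m phi s = phi s by rewrite /phi colE mulmxA exc_idem.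
have E1sym : (E 1)^T = E 1 by apply: (exc_sym excE).
have E2sym : (E 2)^T = E 2 by apply: (exc_sym excE).
have E3sym : (E 3)^T = E 3 by apply: (exc_sym excE).
have phiC r s : D 1 r *m phi s = D 1 s *m phi r by apply: row_diag_colC.
pose B r s := E 2 *m D 1 r *m phi s.
pose t h r s := E 2 *m D 1 h *m B r s.
pose S y x := E 2 *m D 1 x *m E 3 *m D 5 y *m E 2.
have BC r s : B r s = B s r by rewrite /B -!mulmxA phiC.
have tC23 h r s : t h r s = t h s r by rewrite /t BC.
have tC12 h r s : t h r s = t r h s.
  rewrite /t /B -(E1phi s) !mulmxA; congr (_ *m _).
  (* The path from 2 to 1 through label 1 is admissible; it is [a1] that removes it. *)
  have ins a b : E 2 *m D 1 a *m D 1 b *m E 1 =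
                 E 2 *m D 1 a *m E 2 *m D 1 b *m E 1.
    apply: insert_idem => // -[|[|[|[|[|[|//]]]]]] // _ _.
    - by left; apply: (exc_q0 excE).
    - by right.
    - by right; apply: (exc_q0 excE).
    - by right; apply: (exc_q0 excE).
    - by right; apply: (exc_q0 excE).
  by rewrite -!ins -!(mulmxA (E 2)) row_diagC.
have S_sym y x : (S y x)^T = S y x.
  rewrite /S !trmx_mul !tr_row_diag E2sym E3sym !mulmxA.
  exact: insert_adm_sym.
pose z y x a b h r s := (t h r s)^T *m (S y x *m B a b).
have zC12 y x a b h r s : z y x a b h r s = z y a x b h r s.
  have RBC : E 3 *m D 1 x *m B a b = E 3 *m D 1 a *m B x b.
    rewrite /B -(E1phi b) !mulmxA; congr (_ *m _); exact: insert_adm_sym.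
  have SE u : S y u = E 2 *m D 5 y *m (E 3 *m D 1 u *m E 2).
    by rewrite !mulmxA; apply: insert_adm_sym.
  have SB u v : S y u *m B v b = E 2 *m D 5 y *m (E 3 *m D 1 u *m B v b).
    by rewrite SE -!mulmxA; congr (_ *m (_ *m (_ *m (_ *m _))));
      rewrite /B !mulmxA exc_idem.
  by rewrite /z !SB RBC.
have zC23 y x a b h r s : z y x a b h r s = z y x b a h r s.
  by rewrite /z BC.
have zC14 y x a b h r s : z y x a b h r s = z y h a b x r s.
  have RAC : E 3 *m D 1 x *m t h r s = E 3 *m D 1 h *m t x r s.
    rewrite /t /B -!(mulmxA (E 2) (D 1 r)) !mulmxA.
    congr (_ *m _ *m _); exact: insert_adm_sym.
  (* Moving the first half of [S] onto [t] makes [D 1 u] and [D 1 v] adjacent up to an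
     idempotent. *)
  have tS u v : (t v r s)^T *m S y u =
      (E 3 *m D 1 u *m t v r s)^T *m D 5 y *m E 2.
    rewrite /S /t !trmx_mul !tr_row_diag E2sym E3sym !mulmxA.
    by rewrite -(mulmxA _ (E 2) (E 2)) exc_idem.
  by rewrite /z 2!(mulmxA _ (S y _)) !tS RAC.
have zC45 y x a b h r s : z y x a b h r s = z y x a b r h s.
  by rewrite /z tC12.
have zC56 y x a b h r s : z y x a b h r s = z y x a b h s r.
  by rewrite /z tC23.
have z_swap y x a b h r s : z y x a b h r s = z y h r s x a b.
  (* The proved transpositions form the tree 3-2-1-4-5-6, hence generate all permutations; this word
     exchanges the two triples. *)
  rewrite [LHS]zC14 [LHS]zC12 [LHS]zC45 [LHS]zC14 [LHS]zC12 [LHS]zC23 [LHS]zC12.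
  rewrite [LHS]zC56 [LHS]zC45 [LHS]zC14 [LHS]zC12 [LHS]zC23 [LHS]zC56 [LHS]zC45.
  exact: zC56.
have BB : \sum_r \sum_s B r s *m (B r s)^T = q 1 1 2 *: E 2.
  transitivity (\sum_r E 2 *m D 1 r *m E 1 *m D 1 r *m E 2); last first.
    by rewrite -mulmx_suml sum_block // -scalemxAl exc_idem.
  apply: eq_bigr => r _.
  transitivity (E 2 *m D 1 r *m (\sum_s phi s *m (phi s)^T) *m D 1 r *m E 2);
    last by rewrite sum_col_mul_row ?exc_idem.
  rewrite mulmx_sumr !mulmx_suml.
  apply: eq_bigr => s _; rewrite /B !trmx_mul tr_row_diag E2sym.
  by rewrite !mulmxA.
have tt : \sum_h \sum_r \sum_s t h r s *m (t h r s)^T =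
          (q 1 1 2 * q 1 2 2) *: E 2.
  transitivity (\sum_h E 2 *m D 1 h *m (q 1 1 2 *: E 2) *m D 1 h *m E 2).
    apply: eq_bigr => h _; rewrite -BB mulmx_sumr !mulmx_suml.
    apply: eq_bigr => r _; rewrite mulmx_sumr !mulmx_suml.
    apply: eq_bigr => s _; rewrite /t; move: (B r s) => b.
    by rewrite !trmx_mul tr_row_diag E2sym !mulmxA.
  rewrite -mulmx_suml; under eq_bigr => h _ do rewrite -scalemxAr -scalemxAl.
  by rewrite -scaler_sumr sum_block // scalerA -scalemxAl exc_idem.
have SE2 y x : E 2 *m S y x = S y x.
  by rewrite /S !mulmxA exc_idem.
have contract0 y v : \sum_h \sum_r \sum_s
    t h r s *m (v *m (S y h *m B r s))^T = 0 :> 'M_(N, 1).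
  transitivity (\sum_h E 2 *m D 1 h *m (q 1 1 2 *: E 2) *m S y h *m v^T).
    apply: eq_bigr => h _; rewrite -BB mulmx_sumr !mulmx_suml.
    apply: eq_bigr => r _; rewrite mulmx_sumr !mulmx_suml.
    apply: eq_bigr => s _; rewrite /t; move: (B r s) => b.
    by rewrite 2!trmx_mul S_sym !mulmxA.
  transitivity (q 1 1 2 *: (\sum_h E 2 *m D 1 h *m E 2 *m D 1 h) *m
                (E 3 *m D 5 y *m E 2 *m v^T)).
    rewrite scaler_sumr mulmx_suml; apply: eq_bigr => h _.
    rewrite /S -scalemxAr -!scalemxAl !mulmxA -(mulmxA _ (E 2) (E 2)).
    by rewrite exc_idem.
  (* The sum over [h] collapses to a multiple of [E 2], which then meets [E 3]. *)
  rewrite sum_block // -!scalemxAl !mulmxA (exc_mul excE) //=.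
  by rewrite !mul0mx !scaler0.
have pE y x a b : (q 1 1 2 * q 1 2 2) *: (S y x *m B a b) = 0.
  transitivity ((q 1 1 2 * q 1 2 2) *: E 2 *m (S y x *m B a b)).
    by rewrite -scalemxAl mulmxA SE2.
  rewrite -tt -[RHS](contract0 y (t x a b)^T) mulmx_suml.
  apply: eq_bigr => h _; rewrite mulmx_suml; apply: eq_bigr => r _.
  rewrite mulmx_suml; apply: eq_bigr => s _.
  rewrite -mulmxA; congr (_ *m _).
  rewrite [LHS](z_swap y x a b h r s) /z.
  by apply/matrixP=> i j; rewrite [RHS]mxE !ord1.
apply/eqP/negPn/negP => q122N0.
have q112N0 : q 1 1 2 != 0 by apply: (exc_qN0 excE).
have S0 y x : S y x *m E 2 = 0.
  apply: (block_cancel (i := 1) (j := 1)) => // a.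
  (* Column [b] of the product is [S y x *m B a b], since [phi b] is column [b] of [E 1]. *)
  apply/matrixP=> i b; rewrite [RHS]mxE.
  have /eqP := pE y x a b.
  rewrite scaler_eq0 mulf_eq0 (negPf q112N0) (negPf q122N0) => /eqP SB0.
  transitivity ((S y x *m B a b) i 0); last by rewrite SB0 mxE.
  by rewrite /B /phi colE !mulmxA -colE [RHS]mxE.
have E23 x : E 2 *m D 1 x *m E 3 = 0.
  apply: (block_cancel (i := 5) (j := 2)) => // [|y].
    exact: (exc_qN0 excE).
  by rewrite -[RHS](S0 y x) /S -[RHS]mulmxA exc_idem.
have E20 : E 2 = 0.
  rewrite -(exc_idem (i := 2)) //.
  apply: (block_cancel (i := 1) (j := 3)) => // [|x].
    exact: (exc_qN0 excE).
  by rewrite exc_idem.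
by have := exc_neq0 excE (isT : 2 < 6)%N; rewrite E20 eqxx.
Qed.

(** * Associativity of the Hadamard product and the contradiction *)

Lemma exc_assoc i j l m : (i < 6)%N -> (j < 6)%N -> (l < 6)%N -> (m < 6)%N ->
  \sum_(k < 6) q j l k * q i k m = \sum_(k < 6) q i l k * q j k m.
Proof.
move=> i6 j6 l6 m6.
have expand a b c : (a < 6)%N -> (b < 6)%N -> (c < 6)%N ->
    hadamard (E a) (hadamard (E b) (E c)) *m E m =
    (\sum_(k < 6) q b c k * q a k m) *: E m.
  move=> a6 b6 c6; rewrite -[hadamard (E b) _]mulmx1 -(exc_sum excE).
  rewrite mulmx_sumr hadamard_sumr mulmx_suml scaler_suml.
  apply: eq_bigr => k _.
  rewrite (exc_krein excE) // hadamardZr -scalemxAl (exc_krein excE) //.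
  exact: scalerA.
apply/eqP; rewrite -subr_eq0; move: (exc_neq0 excE m6); apply: contraNT => ne.
apply/eqP/(scalerI ne); rewrite scaler0 scalerBl -!expand //.
by rewrite hadamardA (hadamardC (E i)) -hadamardA subrr.
Qed.

End Vanishing.

Lemma not_exceptional (R : realFieldType) (N : nat) (E : nat -> 'M[R]_N) q :
  ~ exceptional E q.
Proof.
move=> excE.
have q122 : q 1 2 2 = 0 by apply: exc_a2 excE.
have q533 : q 5 3 3 = 0 := exc_a2 (exceptional_swap excE).
have := exc_assoc excE (isT : 5 < 6)%N (isT : 1 < 6)%N (isT : 3 < 6)%N
  (isT : 2 < 6)%N.
rewrite !big_ord_recl !big_ord0 /= /bump /= !add1n ?addr0.
rewrite q122 q533 !mulr0 !mul0r.
have q0 i j k : (i < 6)%N -> (j < 6)%N -> (k < 6)%N ->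
  ~~ admissible i j k -> q i j k = 0 by apply: (exc_q0 excE).
rewrite (q0 1 3 0)%N // (q0 1 3 1)%N // (q0 1 3 3)%N // (q0 1 3 5)%N //.
rewrite (q0 5 2 2)%N // (q0 5 3 0)%N // (q0 5 3 1)%N // (q0 5 3 4)%N //.
rewrite (q0 1 5 2)%N // !mul0r !mulr0 !add0r !addr0 => /eqP.
(* The factors are [q 1 3 4], with 4 = 1 + 3, and [q 5 4 2], whose positions 1, 4, 3 in the second
   ordering satisfy 4 = 1 + 3. *)
rewrite mulf_eq0 => /orP[]; apply/negP; exact: (exc_qN0 excE).
Qed.

(** * Passage from association schemes to the abstract data *)

Lemma bose_mesner_sym (R : fieldType) (X : finType) d
    (S : symmetric_scheme X d) (A : 'M[R]_#|X|) :
  A \in bose_mesner R S -> A^T = A.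
Proof.
move=> /(@coord_span _ _ _ (in_tuple _)) ->; rewrite linear_sum.
apply: eq_bigr => k _; rewrite linearZ /=; congr (_ *: _).
have /imageP[i _ ->] := mem_nth 0 (ltn_ord k).
by apply/matrixP=> a b; rewrite !mxE (srel_sym S).
Qed.

Lemma Q_polynomial_exceptional (R : realFieldType) (X : finType)
    (S : symmetric_scheme X 5) (E0 E1 E2 E3 E4 E5 : 'M[R]_#|X|) :
  let E := [tuple E0; E1; E2; E3; E4; E5] in
  Q_polynomial S E -> Q_polynomial S [tuple E0; E5; E3; E2; E4; E1] ->
  exceptional (fun i => tnth E (inord i))
    (fun i j k => #|X|%:R^-1 * krein E (inord i) (inord j) (inord k)).
Proof.
move=> E [primE _ van1 nonvan1] [_ _ van2 nonvan2].
have [basisE E_neq0 mulE sumE] := primE.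
have valI i : (i < 6)%N -> (inord i : 'I_6) = i :> nat by exact: inordK.
have injI i j : (i < 6)%N -> (j < 6)%N ->
    (inord i == inord j :> 'I_6) = (i == j).
  by move=> i6 j6; rewrite -val_eqE /= !valI.
have X_neq0 : #|X|%:R != 0 :> R.
  have [x _] := srel_nonempty S ord0.
  by rewrite pnatr_eq0 -lt0n; apply/card_gt0P; exists x.
have sub_pos : injective (fun i : 'I_6 => inord (pos i) : 'I_6).
  move=> i j /eqP; rewrite injI ?ltn_pos // => /eqP ij.
  by apply/val_inj; rewrite /= -(posK (ltn_ord i)) ij posK.
pose s := perm sub_pos.
have relabel (i j k : 'I_6) :
    krein [tuple E0; E5; E3; E2; E4; E1] i j k = krein E (s i) (s j) (s k).
  rewrite -(krein_relabel s i j k primE); congr krein.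
  apply/eq_from_tnth => l.
  rewrite tnth_mktuple permE !(tnth_nth 0) valI ?ltn_pos //.
  by case: l => [[|[|[|[|[|[|//]]]]]] ?].
(* Label [i] sits at position [pos i] of the second tuple, so its (Q1) and (Q2) are used at
   positions. *)
have sK i : (i < 6)%N -> s (inord (pos i)) = inord i.
  by move=> i6; rewrite permE valI ?ltn_pos // posK.
split.
- move=> i i6; apply: (@bose_mesner_sym _ _ _ S).
  exact: basis_mem basisE (mem_tnth _ _).
- by move=> i j i6 j6; rewrite mulE injI.
- by rewrite -sumE; apply: eq_bigr => i _; rewrite inord_val.
- by move=> i _; apply: E_neq0.
- move=> i j k i6 j6 k6; rewrite (kreinE _ _ X_neq0 primE).
  rewrite -scalemxAl mulmx_suml -scalerA; congr (_ *: _).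
  rewrite (bigD1 (inord k)) //= -scalemxAl mulE eqxx big1 ?addr0 // => l lk.
  by rewrite -scalemxAl mulE (negPf lk) scaler0.
- move=> i j k i6 j6 k6; rewrite negb_and !negbK => /orP[tri|tri].
    by rewrite van1 ?mulr0 // !valI.
  rewrite -(sK i) // -(sK j) // -(sK k) // -relabel.
  by rewrite van2 ?mulr0 // !valI ?ltn_pos.
- move=> i j k i6 j6 k6 deg; rewrite mulf_neq0 ?invr_eq0 //.
  case/orP: deg => deg; first by rewrite nonvan1 // !valI.
  rewrite -(sK i) // -(sK j) // -(sK k) // -relabel.
  by rewrite nonvan2 // !valI ?ltn_pos.
Qed.

Theorem theorem3 (R : realType) :
  ~ exists (X : finType) (S : symmetric_scheme X 5),
      ~ polygon S /\
      exists E0 E1 E2 E3 E4 E5 : 'M[R]_#|X|,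
        Q_polynomial S [tuple E0; E1; E2; E3; E4; E5] /\
        Q_polynomial S [tuple E0; E5; E3; E2; E4; E1].
Proof.
move=> [X [S [_ [E0 [E1 [E2 [E3 [E4 [E5 [Q1 Q2]]]]]]]]]].
exact: not_exceptional (Q_polynomial_exceptional Q1 Q2).
Qed.
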